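(* Let $\bar X=\mathrm{MC}(\alpha_X,P_X)$, $\bar Y=\mathrm{MC}(\alpha_Y,P_Y)$ and $\bar Z=\mathrm{MC}(\alpha_Z,P_Z)$ be homogeneous Markov chains on countable state spaces $A$, $B$, $C$, and let $f:A\to C$, $g:B\to C$ be maps with $(f(\bar X_t))_{t\ge0}\overset{d}{=}\bar Z\overset{d}{=}(g(\bar Y_t))_{t\ge0}$. Suppose that $f$ is a strong lumping of $P_X$ and that $B$ contains no states that are almost surely never visited by $\bar Y$. Let $\Delta=\{(a,b)\in A\times B:f(a)=g(b)\}$ and let $R$ be the matrix with rows and columns indexed by $\Delta$ given by $$R\bigl((a,b),(a',b')\bigr)=\begin{cases}\dfrac{P_X(a,a')P_Y(b,b')}{P_Z(f(a),f(a'))}&\text{if }P_Z(f(a),f(a'))>0,\\0&\text{otherwise.}\end{cases}$$ Let $\varphi=\lim_{m\to\infty}R^m\mathbf 1_\Delta$ (coordinatewise limit, where $\mathbf 1_\Delta$ is the column vector of $1$s indexed by $\Delta$), let $\Delta'=\{(a,b)\in\Delta:\varphi(a,b)>0\}$, and for $(a,b),(a',b')\in\Delta'$ let $P((a,b),(a',b'))=\frac{1}{\varphi(a,b)}R((a,b),(a',b'))\varphi(a',b')$. Then $R$ is a stochastic matrix, so $\varphi\equiv1$, $\Delta'=\Delta$, and $P=R$. Moreover, the projection map $\mathrm{proj}^2:\Delta\to B$, $(a,b)\mapsto b$, is a strong lumping of $P$ to $P_Y$.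
   Context: $\mathrm{MC}(\alpha,P)$ denotes the discrete-time homogeneous Markov chain with time indexed by $\{0,1,2,\dots\}$, initial distribution $\alpha$ and transition matrix $P$. $\overset{d}{=}$ denotes equality in law of processes. Strong lumping: let $f:U\twoheadrightarrow V$ be a surjective map between countable sets. A stochastic matrix $P$ indexed by $U$ lumps strongly under $f$ to a stochastic matrix $Q$ indexed by $V$ (equivalently, $f$ is a strong lumping of $P$ to $Q$) if for every probability distribution $\alpha$ on $U$, the image process $f(\mathrm{MC}(\alpha,P))$, obtained by applying $f$ at each time, has the law of $\mathrm{MC}(f_*(\alpha),Q)$, where $f_*(\alpha)$ is the pushforward of $\alpha$. $f$ is a strong lumping of $P$ if such a $Q$ exists. *)

(* Defs.v *)
From HB Require Import structures.
From mathcomp Require Import all_boot all_order all_algebra.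
From mathcomp Require Import all_classical all_reals all_analysis.

Set Implicit Arguments.
Unset Strict Implicit.
Unset Printing Implicit Defensive.

Import Order.TTheory GRing.Theory Num.Theory.
Import numFieldNormedType.Exports.

Local Open Scope classical_set_scope.
Local Open Scope ring_scope.

Definition distribution (R : realType) (U : countType) (a : U -> R) : Prop :=
  (forall u, 0 <= a u) /\ (\esum_(u in [set: U]) (a u)%:E = 1)%E.

Definition stochastic (R : realType) (U : countType) (P : U -> U -> R) : Prop :=
  forall u, distribution (P u).

Definition pushforward_distribution (R : realType) (U V : countType)
    (f : U -> V) (a : U -> R) : V -> R :=
  fun v => fine (\esum_(u in f @^-1` [set v]) (a u)%:E)%E.

(* Countable state spaces carry the discrete sigma-algebra. *)
Definition process d (T : measurableType d) (U : countType)
    (X : nat -> T -> U) : Prop :=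
  forall (t : nat) (S : set U), measurable (X t @^-1` S).

(* The product of the discrete sigma-algebras on the space of paths. *)
Definition path_measurable (U : countType) : set (set (nat -> U)) :=
  <<s [set E | exists (t : nat) (S : set U), E = [set x | S (x t)]] >>.

Definition trajectory (T U : Type) (X : nat -> T -> U) : T -> (nat -> U) :=
  fun w t => X t w.

Definition eq_law (R : realType) d (T : measurableType d) (Pr : probability T R)
    d' (T' : measurableType d') (Pr' : probability T' R)
    (U : countType) (X : nat -> T -> U) (Y : nat -> T' -> U) : Prop :=
  forall E, path_measurable E ->
    Pr (trajectory X @^-1` E) = Pr' (trajectory Y @^-1` E).

(* The Markov property is written multiplicatively, so that histories of
   probability zero impose no condition on the transition matrix. *)
Record MC (R : realType) d (T : measurableType d) (Pr : probability T R)
    (U : countType) (a : U -> R) (P : U -> U -> R) (X : nat -> T -> U) : Prop := {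
  MC_distribution : distribution a;
  MC_stochastic : stochastic P;
  MC_process : process X;
  MC_initial : forall u, Pr [set w | X 0%N w = u] = (a u)%:E;
  MC_transition : forall (n : nat) (x : nat -> U) (u : U),
    Pr ([set w | forall i, (i <= n)%N -> X i w = x i]
          `&` [set w | X n.+1 w = u])
      = (Pr [set w | forall i, (i <= n)%N -> X i w = x i] * (P (x n) u)%:E)%E
}.

Definition lumps_strongly (R : realType) (U V : countType) (f : U -> V)
    (P : U -> U -> R) (Q : V -> V -> R) : Prop :=
  [/\ (forall v, exists u, f u = v), stochastic P, stochastic Q &
    forall a : U -> R, distribution a ->
    forall d (T : measurableType d) (Pr : probability T R) (X : nat -> T -> U)
           d' (T' : measurableType d') (Pr' : probability T' R)
           (Y : nat -> T' -> V),
      MC Pr a P X -> MC Pr' (pushforward_distribution f a) Q Y ->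
      eq_law Pr Pr' (fun t => f \o X t) Y].

Definition strong_lumping (R : realType) (U V : countType) (f : U -> V)
    (P : U -> U -> R) : Prop :=
  exists Q : V -> V -> R, lumps_strongly f P Q.

Fixpoint matrix_power (R : realType) (U : countType) (M : U -> U -> R)
    (m : nat) (x y : U) : \bar R :=
  match m with
  | 0 => if x == y then 1%E else 0%E
  | m'.+1 => (\esum_(z in [set: U]) ((M x z)%:E * matrix_power M m' z y))%E
  end.

Section FiberProduct.
Variables (R : realType) (A B C : countType) (f : A -> C) (g : B -> C).

Definition Delta : countType := {x : A * B | f x.1 == g x.2}.

Definition proj_snd (x : Delta) : B := (val x).2.

Variables (PX : A -> A -> R) (PY : B -> B -> R) (PZ : C -> C -> R).

Definition Rmat (x y : Delta) : R :=
  let c := f (val x).1 in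
  let c' := f (val y).1 in
  if 0 < PZ c c' then PX (val x).1 (val y).1 * PY (val x).2 (val y).2 / PZ c c'
  else 0.

Definition Rpow1 (m : nat) (x : Delta) : \bar R :=
  (\esum_(y in [set: Delta]) matrix_power Rmat m x y)%E.

Definition phi (x : Delta) : \bar R := lim (Rpow1 m x @[m --> \oo]).

Definition Delta' : set Delta := [set x | (0 < phi x)%E].

(* The transition matrix on [Delta'], written as a total function on [Delta]. *)
Definition Pmat (x y : Delta) : R :=
  (fine (phi x))^-1 * Rmat x y * fine (phi y).

End FiberProduct.

(* Main.v *)
Require Import Defs.
From HB Require Import structures.
From mathcomp Require Import all_boot all_order all_algebra.
From mathcomp Require Import all_classical all_reals all_analysis.

Import Order.TTheory GRing.Theory Num.Theory.
Import numFieldNormedType.Exports.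

(** Strong lumping quantifies over laws of processes, but it amounts to a
    statement about the matrices: f lumps P strongly to Q exactly when, for
    every state u and every v, the sum of P u u' over the fiber of v is
    Q (f u) v. One direction ([lumps_strongly_of_sums]) holds because the fiber
    sums make f(X) a Markov chain with matrix Q ([MC_image]), and initial
    distribution and matrix determine the law of a chain ([MC_eq_law], by the
    pi-lambda theorem). For the other ([sums_of_lumps_strongly]), start the
    chain at u and compare the laws at time 1. The state u may never be visited
    by a given chain, so this needs the existence of a Markov chain with any
    prescribed initial distribution and matrix ([exists_MC]).

    Every state g b is visited by Z, since b is visited by Y. The chains f(X)
    and Z have the same law, hence their matrices have the same row at each
    state visited with positive probability ([MC_transition_unique]). So, for
    a such that f a = g b, the sum of P_X a a' over the fiber of c is
    P_Z (f a) c. Moreover P_Y b b' > 0 forces P_Z (g b) (g b') > 0, because a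
    step of Y from b to b' is seen by Z.

    Now fix (a, b) in the fiber product and sum its row of R over the pairs
    (a', b') with b' fixed. The states a' range over the fiber of g b', where
    the P_X a a' add up to the denominator P_Z (g b) (g b'), and what remains is
    P_Y b b' ([Rmat_fiber_sum]). These sums say at once that R is stochastic
    and that the projection lumps it strongly to P_Y; and a stochastic matrix
    leaves the vector of ones unchanged, whence phi = 1 and P = R. *)

Set Implicit Arguments.
Unset Strict Implicit.
Unset Printing Implicit Defensive.

Local Open Scope classical_set_scope.
Local Open Scope ring_scope.

(* The same name also denotes the law of a random variable. *)
Local Notation distribution := Defs.distribution.

(** * Sums and distributions over countable types *)

Section CountableSums.
Context {R : realType}.
Implicit Types U V : countType.
Local Open Scope ereal_scope.

(** Enumerating the type by its codes reduces unordered sums to series, for which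
    linearity and countable additivity of measures are known. *)
Lemma esum_pickle U (F : U -> \bar R) : (forall u, 0 <= F u) ->
  \esum_(u in [set: U]) F u = \sum_(n <oo) oapp F 0 (@pickle_inv U n).
Proof.
move=> F0; have G0 n : 0 <= oapp F 0 (@pickle_inv U n).
  by case: pickle_inv => //=.
rewrite nneseries_esumT//.
transitivity (\esum_(n in range (@pickle U)) oapp F 0 (@pickle_inv U n)).
  rewrite esum_image; last by move=> u v _ _; exact: (pcan_inj pickleK_inv).
  by apply: eq_esum => u _; rewrite pickleK_inv.
rewrite esum_mkcond; apply: eq_esum => n _; case: ifPn => //.
rewrite notin_setE /= => nr; case E : (@pickle_inv U n) => [u|//].
by case: nr; exists u => //; have := @pickle_invK U n; rewrite /ocancel E.
Qed.

Lemma esumZl U (S : set U) (c : R) (F : U -> \bar R) :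
    (0 <= c)%R -> (forall u, 0 <= F u) ->
  \esum_(u in S) (c%:E * F u) = c%:E * \esum_(u in S) F u.
Proof.
move=> c0 F0; rewrite esum_mkcond [in RHS]esum_mkcond.
have G0 u : 0 <= if u \in S then F u else 0 by case: ifP.
rewrite !esum_pickle//; last by move=> u; case: ifP => // _; rewrite mule_ge0.
rewrite -nneseriesZl//; last by move=> n _; case: pickle_inv => /=.
by apply: eq_eseriesr => n _; case: pickle_inv => [u|] /=; [case: ifP|];
  rewrite ?mule0.
Qed.

Lemma esum_fibers U V (h : U -> V) (F : U -> \bar R) : (forall u, 0 <= F u) ->
  \esum_(u in [set: U]) F u =
  \esum_(v in [set: V]) \esum_(u in h @^-1` [set v]) F u.
Proof.
move=> F0; rewrite (esum_esum (a := fun _ => F))//.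
rewrite (reindex_esum [set: U] _ (fun u => (h u, u)))//.
by split=> [u _|u v _ _ [_]|[v u] /= [_ <-]]//; exists u.
Qed.

Lemma esum_distribution_le1 U (a : U -> R) (S : set U) :
  distribution a -> \esum_(u in S) (a u)%:E <= 1.
Proof.
move=> [a0 <-]; rewrite esum_mkcond; apply: le_esum => u _.
by case: ifP => // _; rewrite lee_fin.
Qed.

Lemma pushforward_distributionE {U V} {f : U -> V} {a : U -> R} v :
  distribution a -> (pushforward_distribution f a v)%:E =
                    \esum_(u in f @^-1` [set v]) (a u)%:E.
Proof.
move=> da; rewrite fineK// ge0_fin_numE; last first.
  by apply: esum_ge0 => u _; rewrite lee_fin da.1.
exact: le_lt_trans (esum_distribution_le1 _ da) (ltry _).
Qed.

Lemma distribution_pushforward {U V} {f : U -> V} {a : U -> R} :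
  distribution a -> distribution (pushforward_distribution f a).
Proof.
move=> da; split=> [v|].
  rewrite -lee_fin pushforward_distributionE//.
  by apply: esum_ge0 => u _; rewrite lee_fin da.1.
under eq_esum do rewrite pushforward_distributionE//.
by rewrite -esum_fibers ?da.2// => u; rewrite lee_fin da.1.
Qed.

Lemma distribution_dirac U (u : U) :
  distribution (fun v : U => (v == u)%:R : R).
Proof.
split=> [v|]; first by rewrite ler0n.
transitivity (\esum_(v in [set u]) ((v == u)%:R : R)%:E).
  rewrite [RHS]esum_mkcond; apply: eq_esum => v _.
  by rewrite in_set1; case: eqP.
by rewrite esum_set1 ?eqxx// lee_fin.
Qed.

End CountableSums.

(** * Histories and the law of a Markov chain *)

Section CountablePartitions.
Context {R : realType} {d} {T : measurableType d}.
Variable (Pr : probability T R).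

Lemma measurable_countable_preimage {U : countType} {h : T -> U} :
  (forall u, measurable (h @^-1` [set u])) ->
  forall S : set U, measurable (h @^-1` S).
Proof.
move=> mh S.
rewrite (_ : h @^-1` S = \bigcup_u (h @^-1` [set u] `&` [set _ | S u])).
  apply: countable_bigcupT_measurable => [|u]; first exact: countableP.
  apply: measurableI => //.
  have [Su|nSu] := pselect (S u).
    by rewrite (_ : [set _ | S u] = setT) //; apply/seteqP; split.
  by rewrite (_ : [set _ | S u] = set0) //; apply/seteqP; split.
apply/seteqP; split=> [w Sw|w [u _ [/= <-]]//].
by exists (h w).
Qed.

Lemma measure_countable_partition {U : countType} {h : T -> U} E (S : set U) :
    (forall u, measurable (h @^-1` [set u])) -> measurable E ->
  Pr (h @^-1` S `&` E) = (\esum_(u in S) Pr (h @^-1` [set u] `&` E))%E.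
Proof.
move=> mh mE; pose F u := h @^-1` ([set u] `&` S) `&` E.
have mF u : measurable (F u).
  by apply: measurableI => //; exact: measurable_countable_preimage.
transitivity (\esum_(u in [set: U]) Pr (F u))%E.
  rewrite esum_pickle//.
  pose G n := if @pickle_inv U n is Some u then F u else set0.
  transitivity (\sum_(n <oo) Pr (G n))%E; last first.
    by apply: eq_eseriesr => n _; rewrite /G; case: pickle_inv => //=.
  have mG n : measurable (G n) by rewrite /G; case: pickle_inv.
  rewrite -measure_semi_bigcup//; last 2 first.
  - move=> n m _ _ [w []]; rewrite /G.
    case En : (@pickle_inv U n) => [u|//] [[/= hu _] _].
    case Em : (@pickle_inv U m) => [v|//] [[/= hv _] _].
    have := @pickle_invK U n; have := @pickle_invK U m; rewrite En Em /=.
    by move=> <- <-; rewrite -hu -hv.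
  - exact: bigcupT_measurable.
  congr (Pr _); apply/seteqP; split=> [w [Sw Ew]|w [n _]].
    by exists (pickle (h w)) => //; rewrite /G pickleK_inv; split.
  by rewrite /G; case: pickle_inv => [u [[_ Sw] Ew]|[]]; split.
rewrite [RHS]esum_mkcond; apply: eq_esum => u _; rewrite /F.
case: ifPn => [/set_mem Su|].
  congr (Pr _); apply/seteqP; split=> w; first by move=> [[hu _] Ew].
  by move=> [hu Ew]; split=> //; split=> //=; rewrite hu.
rewrite notin_setE => nSu; rewrite (_ : _ `&` _ = set0) ?measure0//.
by rewrite -subset0 => w [[/= ->]].
Qed.

End CountablePartitions.

(** The events of this form are a pi-system that generates the sigma-algebra of
    paths, and each is a countable union of cylinders. *)
Definition determined_upto {U : Type} (n : nat) (E : set (nat -> U)) : Prop :=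
  forall x y, (forall i, (i <= n)%N -> x i = y i) -> E x -> E y.

Section Histories.
Context {d} {T : measurableType d} {U : countType}.
Variable X : nat -> T -> U.
Hypothesis pX : process X.

(* The values up to time n, as an element of a countable type. *)
Let hist n (w : T) : n.+1.-tuple U := [tuple X i w | i < n.+1].

Let extend n (s : n.+1.-tuple U) (i : nat) : U := tnth s (inord i).

Let histP n s :
  hist n @^-1` [set s] = [set w | forall i, (i <= n)%N -> X i w = extend s i].
Proof.
apply/seteqP; split=> [w /= <- i|w ws].
  by move=> ni; rewrite /extend tnth_mktuple inordK.
apply: eq_from_tnth => i; rewrite tnth_mktuple ws ?/extend ?inord_val//.
by rewrite -ltnS.
Qed.

Lemma measurable_cylinder n (x : nat -> U) :
  measurable [set w | forall i, (i <= n)%N -> X i w = x i].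
Proof.
rewrite (_ : [set w | _] = \big[setI/setT]_(i < n.+1) (X i @^-1` [set x i])).
  by apply: bigsetI_measurable => i _; exact: pX.
rewrite -(bigcap_mkord n.+1 (fun i => X i @^-1` [set x i])).
apply/seteqP; split=> w /= xw i; last exact: xw.
by rewrite /= => /xw.
Qed.

Let measurable_hist n s : measurable (hist n @^-1` [set s]).
Proof. by rewrite histP; exact: measurable_cylinder. Qed.

Let trajectory_hist n E : determined_upto n E ->
  trajectory X @^-1` E = hist n @^-1` [set s | E (extend s)].
Proof.
move=> dE; have histE w i : (i <= n)%N -> X i w = extend (hist n w) i.
  by move=> ni; rewrite /extend tnth_mktuple inordK.
apply/seteqP; split=> w Ew.
  by apply: dE Ew => i ni; rewrite /trajectory histE.
by apply: (dE (extend (hist n w))) Ew => i ni; rewrite /trajectory -histE.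
Qed.

Lemma measurable_determined n E : determined_upto n E ->
  measurable (trajectory X @^-1` E).
Proof.
move=> /trajectory_hist ->.
by apply: measurable_countable_preimage => s; exact: measurable_hist.
Qed.

(** The cylinders of length n + 1 are countably many and partition the sample
    space, so an event of the past is split into complete histories, to which
    the Markov property applies. *)
Lemma measure_histories {R : realType} (Pr : probability T R) n E D :
    determined_upto n E -> measurable D ->
  Pr (trajectory X @^-1` E `&` D) =
  (\esum_(s in [set s : n.+1.-tuple U | E (fun i => tnth s (inord i))])
     Pr ([set w | forall i, (i <= n)%N -> X i w = tnth s (inord i)] `&` D))%E.
Proof.
move=> /trajectory_hist -> mD.
rewrite measure_countable_partition//; last first.
  by move=> s; exact: measurable_hist.
by apply: eq_esum => s _; rewrite histP.
Qed.

End Histories.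

Section MarkovChains.
Context {R : realType} {d} {T : measurableType d} {Pr : probability T R}.
Context {U : countType} {a : U -> R} {P : U -> U -> R} {X : nat -> T -> U}.
Hypothesis hX : MC Pr a P X.

Lemma MC_cylinder n (x : nat -> U) :
  Pr [set w | forall i, (i <= n)%N -> X i w = x i] =
  (a (x 0%N) * \prod_(i < n) P (x i) (x i.+1))%:E.
Proof.
elim: n => [|n IHn].
  rewrite big_ord0 mulr1 -(MC_initial hX); congr (Pr _).
  by apply/seteqP; split=> w /= xw; [exact: xw|case].
rewrite big_ord_recr /= mulrA EFinM -IHn -(MC_transition hX); congr (Pr _).
apply/seteqP; split=> w /=.
  by move=> xw; split=> [i ni|]; apply: xw => //; exact: leqW.
by move=> [xw xn] i; rewrite leq_eqVlt => /predU1P[->//|]; exact: xw.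
Qed.

(** The Markov property for an arbitrary event E of the past and an arbitrary set
    S of next states: if all histories in E give S the same probability q, then
    averaging over these histories gives q again. *)
Lemma MC_transition_set n (E : set (nat -> U)) (S : set U) (q : R) :
    determined_upto n E -> 0 <= q ->
    (forall x, E x -> (\esum_(u in S) (P (x n) u)%:E = q%:E)%E) ->
  Pr (trajectory X @^-1` E `&` [set w | S (X n.+1 w)]) =
  (Pr (trajectory X @^-1` E) * q%:E)%E.
Proof.
move=> dE q0 Eq; have pX := MC_process hX.
have mS : measurable [set w | S (X n.+1 w)] by exact: pX.
rewrite -[in RHS](setIT (trajectory X @^-1` E)) !(measure_histories pX _ dE)//.
rewrite muleC -esumZl//; apply: eq_esum => s Es; rewrite setIT setIC.
rewrite (@measure_countable_partition _ _ _ Pr _ (X n.+1)); last 2 first.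
- by move=> u; exact: pX.
- exact: measurable_cylinder.
rewrite -(Eq _ Es) muleC.
set p := Pr _; have p01 : p \is a fin_num by rewrite fin_num_measure//;
  exact: measurable_cylinder.
rewrite -(fineK p01) -esumZl ?fine_ge0 ?measure_ge0//; last first.
  by move=> u; rewrite lee_fin (MC_stochastic hX _).1.
apply: eq_esum => u _; rewrite setIC.
by rewrite (MC_transition hX n (fun i => tnth s (inord i))) fineK.
Qed.

(** The image of a Markov chain forgets part of the past, but the probability of
    the next image state depends only on the current image state. So
    [MC_transition_set] applies to the event that the image has a given past. *)
Lemma MC_image {V : countType} (f : U -> V) (Q : V -> V -> R) :
    stochastic Q ->
    (forall u v, (\esum_(u' in f @^-1` [set v]) (P u u')%:E = (Q (f u) v)%:E)%E) ->
  MC Pr (pushforward_distribution f a) Q (fun t => f \o X t).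
Proof.
move=> sQ PQ; have pX := MC_process hX; split=> //.
- exact: distribution_pushforward (MC_distribution hX).
- by move=> t S; exact: (pX t (f @^-1` S)).
- move=> v; rewrite pushforward_distributionE; last exact: MC_distribution hX.
  rewrite (_ : [set _ | _] = X 0%N @^-1` (f @^-1` [set v]) `&` setT) ?setIT//.
  rewrite -[X in Pr X]setIT measure_countable_partition//.
  by apply: eq_esum => u _; rewrite setIT -(MC_initial hX).
- move=> n y v.
  apply: (@MC_transition_set n [set x | forall i, (i <= n)%N -> f (x i) = y i]
    (f @^-1` [set v])).
  + by move=> x x' xx' + i ni; rewrite -xx'// => /(_ i ni).
  + by rewrite (sQ _).1.
  + by move=> x /= xy; rewrite PQ xy.
Qed.

End MarkovChains.

(** Both chains give each cylinder the same probability, hence agree on the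
    pi-system of events determined by finitely many coordinates; the events
    where they agree form a lambda-system. *)
Lemma MC_eq_law {R : realType} {d} {T : measurableType d} {Pr : probability T R}
    {d'} {T' : measurableType d'} {Pr' : probability T' R}
    {U : countType} {a : U -> R} {P : U -> U -> R}
    {X : nat -> T -> U} {Y : nat -> T' -> U} :
  MC Pr a P X -> MC Pr' a P Y -> eq_law Pr Pr' X Y.
Proof.
move=> hX hY; have pX := MC_process hX; have pY := MC_process hY.
pose G := [set E : set (nat -> U) | exists n, determined_upto n E].
pose H := [set E : set (nat -> U) | [/\ measurable (trajectory X @^-1` E),
   measurable (trajectory Y @^-1` E) &
   Pr (trajectory X @^-1` E) = Pr' (trajectory Y @^-1` E)]].
have GI : setI_closed G.
  move=> E F [n dE] [m dF]; exists (maxn n m) => x y xy [Ex Fx].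
  by split; [apply: dE Ex|apply: dF Fx] => i im; apply: xy;
    rewrite leq_max im ?orbT.
have GH : G `<=` H.
  move=> E [n dE]; split; [exact: measurable_determined dE..|].
  rewrite -[X in Pr X]setIT -[X in Pr' X]setIT (measure_histories pX _ dE)//.
  rewrite (measure_histories pY _ dE)//.
  apply: eq_esum => s _; rewrite !setIT.
  by rewrite (MC_cylinder hX) (MC_cylinder hY).
have lH : lambda_system setT H.
  split=> //.
  - by rewrite /H /= !preimage_setT; split=> //; rewrite !probability_setT.
  - move=> E F FE [mXE mYE XYE] [mXF mYF XYF].
    have preD (S : Type) (h : S -> nat -> U) :
      h @^-1` (E `\` F) = h @^-1` E `\` h @^-1` F by [].
    rewrite /H /= !preD; split; [exact: measurableD..|].
    rewrite !measureD//; last 2 first.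
    + by rewrite ltey_eq fin_num_measure.
    + by rewrite ltey_eq fin_num_measure.
    rewrite !setIidr; [|by move=> w; exact: FE..].
    congr (_ - _)%E; [exact: XYE|exact: XYF].
  - move=> F ndF FH; have mX n : measurable (trajectory X @^-1` F n).
      by case: (FH n).
    have mY n : measurable (trajectory Y @^-1` F n) by case: (FH n).
    rewrite /H /= !preimage_bigcup; split; [exact: bigcupT_measurable..|].
    have cX : Pr (trajectory X @^-1` F n) @[n --> \oo] -->
              Pr (\bigcup_n (trajectory X @^-1` F n)).
      apply: nondecreasing_cvg_mu => //; first exact: bigcupT_measurable.
      by move=> n m nm; apply/subsetPset => w; move/subsetPset: (ndF _ _ nm); apply.
    have cY : Pr' (trajectory Y @^-1` F n) @[n --> \oo] -->
              Pr' (\bigcup_n (trajectory Y @^-1` F n)).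
      apply: nondecreasing_cvg_mu => //; first exact: bigcupT_measurable.
      by move=> n m nm; apply/subsetPset => w; move/subsetPset: (ndF _ _ nm); apply.
    rewrite -(cvg_lim _ cX)// -(cvg_lim _ cY)//; congr (lim (_ @ \oo)).
    by apply/funext => n; case: (FH n).
move=> E mE; suff [] : H E by [].
apply: (lambda_system_subset GI lH GH) => //.
move: E mE; apply: sub_sigma_algebra2 => F [t [S ->]].
by exists t => x y xy; rewrite /= xy.
Qed.

(** * Existence of Markov chains *)

Section CumulativeSums.
Context {R : realType} {U : countType}.
Variable (p : U -> R).

(** The distribution p cuts [0, 1[ into intervals of lengths p u, in the order of
    the codes of the states; [cumulative (pickle u)] is the left endpoint of the
    interval of u. Numbers that are the code of no state contribute 0. *)
Definition cumulative (n : nat) : R :=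
  \sum_(k < n) oapp p 0 (@pickle_inv U k).

Lemma cumulativeS_pickle u :
  cumulative (pickle u).+1 = cumulative (pickle u) + p u.
Proof. by rewrite /cumulative big_ord_recr/= pickleK_inv. Qed.

Hypothesis dp : distribution p.

Lemma cumulative_homo : {homo cumulative : m n / (m <= n)%N >-> m <= n}.
Proof.
apply: homo_leq => [//|x y z xy|n]; first exact: le_trans.
rewrite /cumulative big_ord_recr /= lerDl.
by case: pickle_inv => //= u; exact: dp.1.
Qed.

Lemma cumulative_ge0 n : 0 <= cumulative n.
Proof.
by apply: sumr_ge0 => k _; case: pickle_inv => //= u; exact: dp.1.
Qed.

Lemma cumulative_cvg : (cumulative n)%:E @[n --> \oo] --> 1%E.
Proof.
rewrite -dp.2 esum_pickle => [|u]; last by rewrite lee_fin dp.1.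
have E n : (cumulative n)%:E =
    (\sum_(0 <= k < n) oapp (fun u => (p u)%:E) 0 (@pickle_inv U k))%E.
  rewrite big_mkord -sumEFin; apply: eq_bigr => k _.
  by case: pickle_inv.
under eq_fun do rewrite E.
apply: is_cvg_nneseries => n _ _; case: pickle_inv => //= u.
by rewrite lee_fin dp.1.
Qed.

Lemma cumulative_le1 n : cumulative n <= 1.
Proof.
rewrite -lee_fin -(cvg_lim _ cumulative_cvg)//.
apply: lime_ge; first by apply/cvg_ex; exists 1%E; exact: cumulative_cvg.
by exists n => // m nm; rewrite lee_fin cumulative_homo.
Qed.

Lemma cumulative_cover (y : R) : 0 <= y < 1 ->
  exists u, cumulative (pickle u) <= y < cumulative (pickle u) + p u.
Proof.
move=> /andP[y0 y1].
have ex : exists n, y < cumulative n.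
  apply/not_existsP => ny; move: y1; apply/negP; rewrite -leNgt -lee_fin.
  rewrite -(cvg_lim _ cumulative_cvg)//.
  apply: lime_le; first by apply/cvg_ex; exists 1%E; exact: cumulative_cvg.
  by apply: nearW => n; rewrite lee_fin leNgt; exact/negP/ny.
(* The first partial sum that exceeds y does so by the weight of one state. *)
case: (ex_minnP ex) => -[|n] yn min.
  by rewrite /cumulative big_ord0 ltNge y0 in yn.
have ny : cumulative n <= y.
  by rewrite leNgt; apply/negP => /min; rewrite ltnn.
case E : (@pickle_inv U n) => [u|].
  have /= un := @pickle_invK U n; rewrite E /= in un.
  by exists u; rewrite -cumulativeS_pickle un ny.
move: yn; rewrite /cumulative big_ord_recr /= E addr0 => /(le_lt_trans ny).
by rewrite ltxx.
Qed.

Lemma cumulative_inj (y : R) u v :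
  cumulative (pickle u) <= y < cumulative (pickle u) + p u ->
  cumulative (pickle v) <= y < cumulative (pickle v) + p v -> u = v.
Proof.
wlog uv : u v / (pickle u <= pickle v)%N.
  move=> H; have [uv|/ltnW vu] := leqP (pickle u) (pickle v); first exact: H.
  by move=> *; apply/esym/H.
move=> /andP[_ yu] /andP[vy _].
apply: (pcan_inj pickleK_inv); apply/eqP; rewrite eqn_leq uv leqNgt.
apply/negP => /cumulative_homo.
by rewrite cumulativeS_pickle leNgt (le_lt_trans vy).
Qed.

End CumulativeSums.

Section UnitUniform.
Variable R : realType.

Let measurable_unit_itv : measurable (`[0, 1[ : set (measurableTypeR R)).
Proof. exact: measurable_itv. Qed.

(** The half-open interval fits the cells below, which are half-open so that at
    each level they partition it exactly. *)
Definition unit_uniform := mrestr (@lebesgue_measure R) measurable_unit_itv.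

HB.instance Definition _ := Measure.on unit_uniform.

Let unit_uniform_setT : unit_uniform setT = 1%E.
Proof.
rewrite /unit_uniform /mrestr setTI lebesgue_measure_itv /= lte_fin ltr01.
by rewrite sube0.
Qed.

HB.instance Definition _ :=
  Measure_isProbability.Build _ _ _ unit_uniform unit_uniform_setT.

End UnitUniform.

(** A single uniform variable w on [0, 1[ drives the whole chain. The interval is
    cut into cells according to the initial distribution, the cell of each state
    u is cut again in the proportions given by the row of u, and so on; the
    state at time n is read off the cell of level n + 1 that contains w. The
    length of the cell of a history is the probability of that history, so the
    Markov property holds by construction. *)
Section Realization.
Context {R : realType} {U : countType}.
Variables (a : U -> R) (P : U -> U -> R).
Hypotheses (da : distribution a) (sP : stochastic P).

(* Histories are listed with the most recent state first; [law s] is the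
   distribution of the state that follows the history s. *)
Let law (s : seq U) : U -> R := if s is u :: _ then P u else a.

Let law_distribution s : distribution (law s).
Proof. by case: s => [|u s]; [exact: da|exact: sP]. Qed.

Let weight := fix weight (s : seq U) : R :=
  if s is u :: s' then weight s' * law s' u else 1.

Let left := fix left (s : seq U) : R :=
  if s is u :: s' then left s' + weight s' * cumulative (law s') (pickle u)
  else 0.

Let cell s : set R := [set` `[left s, left s + weight s[%R].

Let weight_ge0 s : 0 <= weight s.
Proof. by elim: s => //= u s IHs; rewrite mulr_ge0// (law_distribution s).1. Qed.

Let cellE s w : cell s w <-> left s <= w < left s + weight s.
Proof. by rewrite /cell /= in_itv. Qed.

Let cell_weight_gt0 s w : cell s w -> 0 < weight s.
Proof.
by rewrite cellE => /andP[lw wl]; have := le_lt_trans lw wl; rewrite ltrDl.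
Qed.

Let cell_cons u s w : cell (u :: s) w <->
  cell s w /\ cumulative (law s) (pickle u) <= (w - left s) / weight s
              < cumulative (law s) (pickle u) + law s u.
Proof.
have cE : 0 < weight s -> cell (u :: s) w <->
    cumulative (law s) (pickle u) <= (w - left s) / weight s
              < cumulative (law s) (pickle u) + law s u.
  move=> s0; rewrite cellE /= ler_pdivlMr// ltr_pdivrMr//.
  by rewrite lerBrDl ltrBlDl -addrA -mulrDr ![_ * weight s]mulrC.
split=> [usw|[sw]]; last by apply: (cE _).2; exact: cell_weight_gt0 sw.
have s0 : 0 < weight s.
  rewrite lt_neqAle weight_ge0 andbT; apply/eqP => s0.
  by have := cell_weight_gt0 usw; rewrite /= -s0 mul0r ltxx.
have /(cE s0) usw' := usw; split=> //; apply/cellE.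
have /andP[lw wl] := usw'.
have y0 : 0 <= (w - left s) / weight s by rewrite (le_trans _ lw) ?cumulative_ge0.
have y1 : (w - left s) / weight s < 1.
  by rewrite (lt_le_trans wl)// -cumulativeS_pickle cumulative_le1.
move: y0 y1; rewrite ler_pdivlMr// ltr_pdivrMr// mul0r mul1r subr_ge0 ltrBlDl.
by move=> -> ->.
Qed.

Let cell_nil w : cell [::] w <-> 0 <= w < 1.
Proof. by rewrite cellE /= add0r. Qed.

Let cell_sub_nil s w : cell s w -> cell [::] w.
Proof. by elim: s => // u s IHs /cell_cons[/IHs]. Qed.

Let cell_extend s w : cell s w -> exists u, cell (u :: s) w.
Proof.
move=> sw; have s0 := cell_weight_gt0 sw.
have y01 : 0 <= (w - left s) / weight s < 1.
  move: sw => /cellE; rewrite ler_pdivlMr// ltr_pdivrMr// mul0r mul1r.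
  by rewrite subr_ge0 ltrBlDl.
have [u uw] := cumulative_cover (law_distribution s) y01.
by exists u; apply/cell_cons.
Qed.

Let inhabited : exists u, cell [:: u] 0.
Proof. by apply: cell_extend; apply/cell_nil; rewrite lexx ltr01. Qed.

(* A default state, needed for the points w outside [0, 1[. *)
Let u0 : U := projT1 (cid inhabited).

Let history := fix history (n : nat) (w : R) : seq U :=
  if n is n'.+1 then
    let s := history n' w in xget u0 [set u | cell (u :: s) w] :: s
  else [::].

Let size_history n w : size (history n w) = n.
Proof. by elim: n => //= n ->. Qed.

Let history_cell n w s : 0 <= w < 1 -> size s = n ->
  history n w = s <-> cell s w.
Proof.
move=> w01; elim: n s => [|n IHn] s.
  by move/size0nil => ->; split=> // _; apply/cell_nil.
case: s => // u s [sn] /=; split.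
  move=> [<- hs]; have sw : cell s w by exact/IHn.
  by rewrite hs; exact: (xgetPex u0 (cell_extend sw)).
move=> usw; have [sw uw] := (cell_cons _ _ _).1 usw.
rewrite (IHn _ sn).2//; congr (_ :: _); apply: xget_unique => //= v vsw.
have [_ vw] := (cell_cons _ _ _).1 vsw.
exact: cumulative_inj (law_distribution s) _ _ _ vw uw.
Qed.

Let history_outside n w : ~ (0 <= w < 1) -> history n w = nseq n u0.
Proof.
move=> w01; elim: n => //= n ->; congr (_ :: _); apply: xgetPN => //= u.
by move/cell_sub_nil/cell_nil.
Qed.

Let history_preimage n s : size s = n ->
  history n @^-1` [set s] `&` `[0, 1[ = cell s.
Proof.
move=> sn; apply/seteqP; split=> w.
  by move=> [/= hs]; rewrite in_itv /= => w01; apply/(history_cell w01 sn).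
move=> sw; have w01 : 0 <= w < 1 by apply/cell_nil; exact: cell_sub_nil sw.
by split; rewrite /= ?in_itv//; apply/(history_cell w01 sn).
Qed.

Let measurable_history n s :
  measurable (history n @^-1` [set s] : set (measurableTypeR R)).
Proof.
have mI : measurable (`[0, 1[ : set (measurableTypeR R)).
  exact: measurable_itv.
rewrite -[X in measurable X]setIT -(setUv `[0, 1[%classic) setIUr.
apply: measurableU.
  have [sn|sn] := eqVneq (size s) n.
    by rewrite history_preimage//; exact: measurable_itv.
  rewrite (_ : _ `&` _ = set0)//; apply/seteqP; split=> // w [/= hs _].
  by move: sn; rewrite -hs size_history eqxx.
have [sn|sn] := eqVneq s (nseq n u0).
  rewrite (_ : _ `&` _ = ~` `[0, 1[%classic); first exact: measurableC.
  apply/seteqP; split=> w; first by case.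
  by move=> w01; split=> //; rewrite /= sn history_outside.
rewrite (_ : _ `&` _ = set0)//; apply/seteqP; split=> // w [/= hs].
rewrite in_itv /= => w01.
by move: sn; rewrite -hs history_outside// eqxx.
Qed.

Let chain (n : nat) (w : R) : U := head u0 (history n.+1 w).

Let history_cons n u s : history n.+1 @^-1` [set u :: s] =
  history n @^-1` [set s] `&` [set w | chain n w = u].
Proof.
apply/seteqP; split=> w; first by case=> <- <-.
by move=> [] /= <- <-.
Qed.

Let path := fix path (x : nat -> U) (n : nat) : seq U :=
  if n is n'.+1 then x n' :: path x n' else [::].

Let size_path x n : size (path x n) = n.
Proof. by elim: n => //= n ->. Qed.

Let chain_path x n :
  [set w | forall i, (i <= n)%N -> chain i w = x i] =
  history n.+1 @^-1` [set path x n.+1].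
Proof.
elim: n => [|n IHn].
  by apply/seteqP; split=> w /= => [/(_ 0%N isT)|[xw] []]//; rewrite /chain /= => ->.
transitivity ([set w | forall i, (i <= n)%N -> chain i w = x i] `&`
              [set w | chain n.+1 w = x n.+1]).
  apply/seteqP; split=> w /=.
    by move=> xw; split=> [i ni|]; apply: xw => //; exact: leqW.
  by move=> [xw xn] i; rewrite leq_eqVlt => /predU1P[->//|]; exact: xw.
by rewrite IHn -history_cons.
Qed.

Let uniform_history n s : size s = n ->
  @unit_uniform R (history n @^-1` [set s]) = (weight s)%:E.
Proof.
move=> sn; rewrite /unit_uniform /mrestr history_preimage//.
rewrite lebesgue_measure_itv /= lte_fin ltrDl.
case: ltP => [_|w0]; first by rewrite -EFinB addrAC subrr add0r.
by congr (_%:E); apply/eqP; rewrite eq_le w0 weight_ge0.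
Qed.

Let MC_chain : MC (@unit_uniform R) a P chain.
Proof.
split=> //.
- move=> t S; rewrite (_ : _ @^-1` _ = history t.+1 @^-1` (head u0 @^-1` S))//.
  exact: measurable_countable_preimage.
- move=> u; have := @uniform_history 1 [:: u] erefl.
  rewrite /= mul1r => <-; congr (@unit_uniform R _).
  by apply/seteqP; split=> w /= => [|[]//]; rewrite /chain /= => ->.
- move=> n x u; rewrite (_ : _ `&` _ =
    history n.+2 @^-1` [set u :: path x n.+1]); last first.
    by rewrite chain_path -history_cons.
  rewrite chain_path [LHS]uniform_history ?size_path ?EFinM//=; last first.
    by rewrite size_path.
  congr (_ * _)%E; apply/esym.
  by apply: (@uniform_history n.+1 (path x n.+1)); rewrite size_path.
Qed.

(** Starting a chain at an arbitrary state is what turns an equality of laws into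
    information on all rows of a matrix. *)
Lemma exists_MC : exists d (T : measurableType d) (Pr : probability T R)
  (X : nat -> T -> U), MC Pr a P X.
Proof. by exists _, _, (@unit_uniform R), chain; exact: MC_chain. Qed.

End Realization.

(** * Strong lumping in terms of fiber sums *)

Lemma lumps_strongly_of_sums {R : realType} {U V : countType} (f : U -> V)
    (P : U -> U -> R) (Q : V -> V -> R) :
  (forall v, exists u, f u = v) -> stochastic P -> stochastic Q ->
  (forall u v, (\esum_(u' in f @^-1` [set v]) (P u u')%:E = (Q (f u) v)%:E)%E) ->
  lumps_strongly f P Q.
Proof.
move=> surj sP sQ PQ; split=> // a _ d T Pr X d' T' Pr' Y hX hY.
exact: MC_eq_law (MC_image hX sQ PQ) hY.
Qed.

(** The row of u is the law at time 1 of a chain that starts at u. *)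
Lemma MC_first_step {R : realType} {d} {T : measurableType d}
    {Pr : probability T R} {U : countType} {a : U -> R} {P : U -> U -> R}
    {X : nat -> T -> U} (u : U) (S : set U) :
  MC Pr a P X -> a u = 1 ->
  Pr (X 1%N @^-1` S) = (\esum_(u' in S) (P u u')%:E)%E.
Proof.
move=> hX au; have pX := MC_process hX.
have Pu : Pr [set w | X 0%N w = u] = 1%E by rewrite (MC_initial hX) au.
have mu : measurable [set w | X 0%N w = u] by exact: (pX 0%N [set u]).
have Pc : Pr (~` [set w | X 0%N w = u]) = 0%E.
  by rewrite probability_setC// Pu subee.
have mS : measurable (X 1%N @^-1` S) by exact: pX.
have fs : (\esum_(u' in S) (P u u')%:E \is a fin_num)%E.
  rewrite ge0_fin_numE; last first.
    by apply: esum_ge0 => u' _; rewrite lee_fin (MC_stochastic hX _).1.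
  exact: le_lt_trans (esum_distribution_le1 _ (MC_stochastic hX u)) (ltry _).
rewrite (measureDI _ mS mu) [X in (X + _)%E](_ : _ = 0%E) ?add0e; last first.
  apply: (@subset_measure0 _ _ _ Pr _ (~` [set w | X 0%N w = u])).
  - exact: measurableD.
  - exact: measurableC.
  - by move=> w [].
  - exact: Pc.
have := @MC_transition_set _ _ _ _ _ _ _ _ hX 0%N
  [set x | x 0%N = u] S (fine (\esum_(u' in S) (P u u')%:E)%E).
rewrite -[trajectory X @^-1` _]/[set w | X 0%N w = u] Pu mul1e fineK// setIC.
apply.
- by move=> x y xy /= <-; rewrite xy.
- by apply: fine_ge0; apply: esum_ge0 => u' _; rewrite lee_fin (MC_stochastic hX _).1.
- by move=> x /= ->.
Qed.

Lemma sums_of_lumps_strongly {R : realType} {U V : countType} (f : U -> V)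
    (P : U -> U -> R) (Q : V -> V -> R) : lumps_strongly f P Q ->
  forall u v, (\esum_(u' in f @^-1` [set v]) (P u u')%:E = (Q (f u) v)%:E)%E.
Proof.
move=> [_ sP sQ law] u v; pose a w : R := (w == u)%:R.
have da : distribution a by exact: distribution_dirac.
have [d [T [Pr [X hX]]]] := exists_MC da sP.
have [d' [T' [Pr' [Y hY]]]] :=
  exists_MC (distribution_pushforward (f := f) da) sQ.
have fa : pushforward_distribution f a (f u) = 1.
  apply: EFin_inj; rewrite pushforward_distributionE// -da.2 esum_mkcond.
  apply: eq_esum => w _; rewrite /a; have [->|] := eqVneq w u.
    by rewrite mem_set.
  by case: ifP.
have mv : path_measurable [set x : nat -> V | x 1%N = v].
  by apply: sub_sigma_algebra; exists 1%N, [set v].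
have := law a da _ _ _ _ _ _ _ _ hX hY _ mv.
rewrite -[trajectory _ @^-1` _]/(X 1%N @^-1` (f @^-1` [set v])).
rewrite -[trajectory _ @^-1` _]/(Y 1%N @^-1` [set v]).
rewrite (MC_first_step (f @^-1` [set v]) hX (u := u)) ?/a ?eqxx//.
rewrite (MC_first_step [set v] hY fa) esum_set1// lee_fin.
by rewrite (sQ _).1.
Qed.

Lemma path_measurable_pair {U : countType} t t' (S S' : set U) :
  path_measurable [set x | S (x t) /\ S' (x t')].
Proof.
have [_ _ _ +] := (sigma_algebraP (fun E _ => @subsetT _ E)).1
  (smallest_sigma_algebra setT
    [set E | exists (t : nat) (S : set U), E = [set x : nat -> U | S (x t)]]).
apply; apply: sub_sigma_algebra; [by exists t, S|by exists t', S'].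
Qed.

Lemma MC_two_steps {R : realType} {d} {T : measurableType d}
    {Pr : probability T R} {U : countType} {a : U -> R} {P : U -> U -> R}
    {X : nat -> T -> U} t (u v : U) : MC Pr a P X ->
  Pr [set w | X t w = u /\ X t.+1 w = v] =
  (Pr [set w | X t w = u] * (P u v)%:E)%E.
Proof.
move=> hX.
apply: (@MC_transition_set _ _ _ _ _ _ _ _ hX t [set x | x t = u] [set v]).
- by move=> x y xy /= <-; rewrite xy.
- by rewrite (MC_stochastic hX _).1.
- by move=> x /= ->; rewrite esum_set1// lee_fin (MC_stochastic hX _).1.
Qed.

(** The law of a chain determines the row of each state visited with positive
    probability, as a conditional probability; other rows are arbitrary. *)
Lemma MC_transition_unique {R : realType}
    {d} {T : measurableType d} {Pr : probability T R}
    {d'} {T' : measurableType d'} {Pr' : probability T' R} {U : countType}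
    {a a' : U -> R} {P P' : U -> U -> R}
    {X : nat -> T -> U} {X' : nat -> T' -> U} t (u v : U) :
  MC Pr a P X -> MC Pr' a' P' X' -> eq_law Pr Pr' X X' ->
  Pr [set w | X t w = u] <> 0%E -> P u v = P' u v.
Proof.
move=> hX hX' XX' Pu.
have E1 := XX' _ (path_measurable_pair t t [set u] setT).
have E2 := XX' _ (path_measurable_pair t t.+1 [set u] [set v]).
have eqT (O : Type) (Z : nat -> O -> U) :
    trajectory Z @^-1` [set x | [set u] (x t) /\ setT (x t)] = [set w | Z t w = u].
  by apply/seteqP; split=> w //= [].
rewrite !eqT in E1; move: E2.
rewrite -[trajectory X @^-1` _]/[set w | X t w = u /\ X t.+1 w = v].
rewrite -[trajectory X' @^-1` _]/[set w | X' t w = u /\ X' t.+1 w = v].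
rewrite (MC_two_steps _ _ _ hX) (MC_two_steps _ _ _ hX') -E1.
have fu : Pr [set w | X t w = u] \is a fin_num.
  by rewrite fin_num_measure//; exact: (MC_process hX t [set u]).
have p0 : fine (Pr [set w | X t w = u]) != 0.
  by apply/eqP => p0; apply: Pu; rewrite -(fineK fu) p0.
by rewrite -(fineK fu) -!EFinM => -[/(mulfI p0)].
Qed.

(** * Powers of a stochastic matrix *)

Section MatrixPowers.
Context {R : realType} {U : countType}.
Variable M : U -> U -> R.
Hypothesis sM : stochastic M.
Local Open Scope ereal_scope.

Lemma matrix_power_ge0 m x y : 0 <= matrix_power M m x y.
Proof.
elim: m x => [|m IHm] x /=; first by case: ifP.
by apply: esum_ge0 => z _; rewrite mule_ge0// lee_fin (sM _).1.
Qed.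

Lemma matrix_power_row_sum m x :
  \esum_(y in [set: U]) matrix_power M m x y = 1.
Proof.
elim: m x => [|m IHm] x.
  rewrite -[RHS](@esum_set1 R U x (fun _ => 1))// [RHS]esum_mkcond.
  by apply: eq_esum => y _; rewrite /= in_set1 eq_sym.
transitivity (\esum_(z in [set: U]) \esum_(y in [set: U])
    ((M x z)%:E * matrix_power M m z y)).
  have M0 z y : 0 <= (M x z)%:E * matrix_power M m z y.
    by rewrite mule_ge0 ?matrix_power_ge0// lee_fin (sM _).1.
  rewrite (esum_esum (a := fun y z => (M x z)%:E * matrix_power M m z y))//.
  rewrite (esum_esum (a := fun z y => (M x z)%:E * matrix_power M m z y))//.
  rewrite (reindex_esum ([set: U] `*`` fun=> [set: U]) _ (fun k => (k.2, k.1)))//.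
  by split=> [[]|[? ?] [? ?] _ _ [-> ->]|[y z] _]//; exists (z, y).
rewrite -(sM x).2; apply: eq_esum => z _.
rewrite esumZl ?(sM _).1//; first by rewrite IHm mule1.
by move=> y; exact: matrix_power_ge0.
Qed.

End MatrixPowers.

(** * Rows of the fiber product matrix *)

Section FiberProductRows.
Context {R : realType} {A B C : countType} {f : A -> C} {g : B -> C}.
Variables (PX : A -> A -> R) (PY : B -> B -> R) (PZ : C -> C -> R).
Hypotheses (sX : stochastic PX) (sY : stochastic PY).
Hypothesis PXZ : forall a b c, f a = g b ->
  (\esum_(a' in f @^-1` [set c]) (PX a a')%:E = (PZ (f a) c)%:E)%E.
Hypothesis PYZ : forall b b', 0 < PY b b' -> 0 < PZ (g b) (g b').

Let Rm := Rmat (f := f) (g := g) PX PY PZ.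

Lemma Rmat_ge0 x y : 0 <= Rm x y.
Proof.
rewrite /Rm /Rmat; case: ifP => // PZ0.
by rewrite divr_ge0 ?mulr_ge0 ?(sX _).1 ?(sY _).1 ?ltW.
Qed.

(** The states over b are the pairs (a, b) with a in the fiber of g b, over which
    the row of PX sums to the denominator. When the denominator vanishes the row
    of R is 0 there, and so is PY by [PYZ]. *)
Lemma Rmat_fiber_sum (x : Delta f g) (b : B) :
  (\esum_(y in @proj_snd A B C f g @^-1` [set b]) (Rm x y)%:E
   = (PY (proj_snd x) b)%:E)%E.
Proof.
have fgx : f (val x).1 = g (val x).2 by exact/eqP/(valP x).
pose q := if 0 < PZ (f (val x).1) (g b)
          then PY (val x).2 b / PZ (f (val x).1) (g b) else 0.
have q0 : 0 <= q.
  by rewrite /q; case: ifP => // PZ0; rewrite divr_ge0 ?(sY _).1 ?ltW.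
transitivity (\esum_(a in f @^-1` [set g b]) (q%:E * (PX (val x).1 a)%:E))%E.
  rewrite (reindex_esum (@proj_snd A B C f g @^-1` [set b]) _
    (fun y => (val y).1)); last first.
    split=> [y /= <-|y z /[!inE] /= yb zb yz|a /= fa].
    - exact/eqP/(valP y).
    - apply: val_inj; rewrite (surjective_pairing (val y)).
      by rewrite (surjective_pairing (val z)) yz; congr (_, _); rewrite [LHS]yb.
    - have fab : f (a, b).1 == g (a, b).2 by exact/eqP.
      by exists (exist _ (a, b) fab).
  apply: eq_esum => y /= yb; rewrite -EFinM /q -yb /Rm /Rmat /proj_snd.
  have -> : f (val y).1 = g (val y).2 by exact/eqP/(valP y).
  by case: ifP; rewrite ?mul0r// -mulrA mulrC.
rewrite esumZl// => [|a]; last by rewrite lee_fin (sX _).1.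
rewrite (PXZ _ fgx) -EFinM /q /proj_snd; congr (_%:E).
case: ifPn => [PZ0|]; first by rewrite divfK ?gt_eqF.
rewrite mul0r -leNgt => PZ0; apply/esym/eqP; rewrite eq_le (sY _).1 andbT leNgt.
by apply/negP => /PYZ; rewrite -fgx ltNge PZ0.
Qed.

Lemma Rmat_stochastic : stochastic Rm.
Proof.
move=> x; split; first exact: Rmat_ge0.
rewrite (esum_fibers (@proj_snd A B C f g)) => [|y]; last first.
  by rewrite lee_fin Rmat_ge0.
by under eq_esum do rewrite Rmat_fiber_sum; rewrite (sY _).2.
Qed.

End FiberProductRows.

(** There are countably many times, and a countable union of negligible events is
    negligible. *)
Lemma visited_state {R : realType} {d} {T : measurableType d}
    {Pr : probability T R} {U : countType} {X : nat -> T -> U} (u : U) :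
  process X -> ~ {ae Pr, forall w, forall t : nat, X t w <> u} ->
  exists t, Pr [set w | X t w = u] <> 0%E.
Proof.
move=> pX; apply: contra_notP => /forallNP Xu.
apply: (@negligibleS _ _ _ Pr (\bigcup_t [set w | X t w = u])).
  by move=> w /existsNP[t /contrapT Xtw]; exists t.
apply: negligible_bigcup => t; exists [set w | X t w = u]; split=> //.
  exact: (pX t [set u]).
exact: (contrapT (Xu t)).
Qed.

Theorem proposition9 (R : realType) (A B C : countType)
  (dX dY dZ : measure_display)
  (OX : measurableType dX) (OY : measurableType dY) (OZ : measurableType dZ)
  (PrX : probability OX R) (PrY : probability OY R) (PrZ : probability OZ R)
  (X : nat -> OX -> A) (Y : nat -> OY -> B) (Z : nat -> OZ -> C)
  (aX : A -> R) (PX : A -> A -> R)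
  (aY : B -> R) (PY : B -> B -> R)
  (aZ : C -> R) (PZ : C -> C -> R)
  (hX : MC PrX aX PX X) (hY : MC PrY aY PY Y) (hZ : MC PrZ aZ PZ Z)
  (f : A -> C) (g : B -> C)
  (hfZ : eq_law PrX PrZ (fun t => f \o X t) Z)
  (hZg : eq_law PrZ PrY Z (fun t => g \o Y t))
  (hf : strong_lumping f PX)
  (hB : forall b : B, ~ {ae PrY, forall w, forall t : nat, Y t w <> b}) :
  stochastic (Rmat (f := f) (g := g) PX PY PZ) /\
  (forall x : Delta f g, cvg (Rpow1 PX PY PZ m x @[m --> \oo])) /\
  (forall x : Delta f g, phi PX PY PZ x = 1%E) /\
  Delta' (f := f) (g := g) PX PY PZ = [set: Delta f g] /\
  (forall x y : Delta f g, Pmat PX PY PZ x y = Rmat PX PY PZ x y) /\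
  lumps_strongly (@proj_snd A B C f g) (Pmat PX PY PZ) PY.
Proof.
have [Q lQ] := hf; have PXQ := sums_of_lumps_strongly lQ.
have [surj sX sQ _] := lQ.
have sY := MC_stochastic hY; have sZ := MC_stochastic hZ.
have pY := MC_process hY; have pZ := MC_process hZ.
have mY t (b : B) : measurable [set w | Y t w = b] by exact: (pY t [set b]).
have gY_visits b : exists t, PrY [set w | Y t w = b] <> 0%E /\
    PrZ [set w | Z t w = g b] <> 0%E.
  have [t Yb] := visited_state pY (@hB b).
  exists t; split=> // Zb; apply: Yb.
  apply: (@subset_measure0 _ _ _ PrY _ [set w | g (Y t w) = g b]).
  - exact: mY.
  - exact: (pY t (g @^-1` [set g b])).
  - by move=> w /= ->.
  - have E := hZg _ (path_measurable_pair t t [set g b] [set g b]).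
    rewrite (_ : [set w | _] = trajectory (fun t => g \o Y t) @^-1`
      [set x | [set g b] (x t) /\ [set g b] (x t)]).
      rewrite -[LHS]E -Zb; congr (PrZ _).
      by apply/seteqP; split=> w /= => [[]|].
    by apply/seteqP; split=> w /= => [|[]].
(* Both f(X) and Z are chains with the same law, and Z visits g b. *)
have PXZ a b c : f a = g b ->
    (\esum_(a' in f @^-1` [set c]) (PX a a')%:E = (PZ (f a) c)%:E)%E.
  move=> fgab; rewrite PXQ; congr (_%:E).
  have [t [_]] := gY_visits b; rewrite -fgab => Zfa.
  apply/esym; apply: (MC_transition_unique (t := t) c hZ (MC_image hX sQ PXQ)) => //.
  by move=> E mE; rewrite hfZ.
(* If PZ vanished, the step from b to b' of Y would have probability 0. *)
have PYZ b b' : 0 < PY b b' -> 0 < PZ (g b) (g b').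
  move=> PYb; rewrite lt_neqAle (sZ _).1 andbT; apply/eqP => PZ0.
  have [t [Yb _]] := gY_visits b.
  have := MC_two_steps t b b' hY.
  rewrite (_ : PrY [set w | Y t w = b /\ _] = 0%E).
    move=> /esym/eqP; rewrite mule_eq0 => /orP[/eqP//|].
    by rewrite eqe gt_eqF.
  apply: (@subset_measure0 _ _ _ PrY _
    [set w | g (Y t w) = g b /\ g (Y t.+1 w) = g b']).
  - by apply: measurableI; exact: mY.
  - by apply: measurableI; [exact: (pY t (g @^-1` [set g b]))|
      exact: (pY t.+1 (g @^-1` [set g b']))].
  - by move=> w /= [-> ->].
  - have E := hZg _ (path_measurable_pair t t.+1 [set g b] [set g b']).
    by rewrite -[LHS]E [LHS](MC_two_steps t (g b) (g b') hZ) -PZ0 mule0.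
have sR := Rmat_stochastic sX sY PXZ PYZ.
have R1 (x : Delta f g) m : Rpow1 PX PY PZ m x = 1%E.
  exact: matrix_power_row_sum.
have cR (x : Delta f g) : Rpow1 PX PY PZ m x @[m --> \oo] --> 1%E.
  by under eq_fun do rewrite R1; exact: cvg_cst.
have phi1 (x : Delta f g) : phi PX PY PZ x = 1%E by exact: cvg_lim (cR x).
have PR (x y : Delta f g) : Pmat PX PY PZ x y = Rmat PX PY PZ x y.
  by rewrite /Pmat !phi1 /= invr1 mul1r mulr1.
split=> //; split; first by move=> x; apply/cvg_ex; exists 1%E; exact: cR.
split=> //; split.
  by apply/seteqP; split=> // x _; rewrite /Delta' /= phi1 lte01.
split=> //.
have -> : Pmat (f := f) (g := g) PX PY PZ = Rmat PX PY PZ.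
  by apply/funext => x; apply/funext => y; exact: PR.
apply: lumps_strongly_of_sums => //.
- move=> b; have [a fa] := surj (g b).
  have fab : f (a, b).1 == g (a, b).2 by exact/eqP.
  by exists (exist _ (a, b) fab).
- exact: Rmat_fiber_sum.
Qed.
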